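(* Let $\mathcal{H}$ be a complex Hilbert space and let $A\in\mathcal{B}(\mathcal{H})$. Then $$\frac12\|A^*A+AA^*\|-\frac14\left\|(A+A^* )^2(A-A^* )^2\right\|^{1/2}\le w^2(A)\le \frac12\|A^*A+AA^*\|.$$
   Context: $\mathcal{B}(\mathcal{H})$ is the set of bounded linear operators on $\mathcal{H}$, $A^*$ is the adjoint of $A$, and $\|\cdot\|$ is the operator norm. The numerical radius is $w(A)=\sup\{|\langle Ax,x\rangle| : x\in\mathcal{H},\ \|x\|=1\}$, and $w^2(A)=(w(A))^2$. *)

(* Defs.v *)
From HB Require Import structures.
From mathcomp Require Import all_boot all_order all_algebra.
From mathcomp Require Import all_classical all_reals all_analysis.
From mathcomp Require Import complex.

Set Implicit Arguments.
Unset Strict Implicit.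
Unset Printing Implicit Defensive.

Import Order.TTheory GRing.Theory Num.Theory.
Import numFieldNormedType.Exports.

Local Open Scope classical_set_scope.
Local Open Scope ring_scope.
Local Open Scope complex_scope.

(* Inner products are linear in the first argument and conjugate-linear in the
   second. Completeness is that of the norm of the underlying normed module,
   which [inner_normE] identifies with the norm of the inner product. *)
HB.mixin Record CompleteNormedModule_isHilbert (R : realType) H
    & CompleteNormedModule R[i] H := {
  inner : {dot H for (@Num.conj R[i])} ;
  inner_normE : forall x : H, `|x| ^+ 2 = inner x x
}.

#[short(type="hilbertType")]
HB.structure Definition Hilbert (R : realType) :=
  {H of CompleteNormedModule R[i] H & CompleteNormedModule_isHilbert R H}.

Section operators.
Context {R : realType} {H : hilbertType R}.
Implicit Types A B : H -> H.

Definition bounded_operator A :=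
  linear A /\ exists M : R, forall x, `|A x| <= M%:C * `|x|.

(* Norms over R[i] take values in R[i] (with zero imaginary part), hence the
   projections [complex.Re] to the reals, where suprema are taken. *)
Definition opnorm A : R :=
  sup [set complex.Re `|A x| | x in [set x : H | `|x| <= 1]].

Definition numerical_radius A : R :=
  sup [set complex.Re `|inner (A x) x| | x in [set x : H | `|x| = 1]].

(* The operator B with <A x, y> = <x, B y> for all x, y: for a bounded operator
   A, it exists by the Riesz representation theorem, and it is unique. *)
Definition adjoint A : H -> H :=
  get [set B | forall x y, inner (A x) y = inner x (B y)].

End operators.

(* Main.v *)
Require Import Defs.
From HB Require Import structures.
From mathcomp Require Import all_boot all_order all_algebra.
From mathcomp Require Import all_classical all_reals all_analysis.
From mathcomp Require Import complex ring lra.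

(* Let S be the adjoint of A, and put B = A + S, C = A - S. Then |B| and |C| are
   at most 2 w(A), and B^2 - C^2 = 2 (S A + A S). Since B is self-adjoint,
   |B u - C v|^2 <= (4 w(A)^2 + |BC|) (|u|^2 + |v|^2); taking u = B x, v = C x
   bounds |B^2 - C^2| by 4 w(A)^2 + |BC|. Finally |BC|^2 <= |B^2 C^2|: the
   self-adjoint operator P = C B^2 C satisfies P^(n+1) = C (B^2 C^2)^n B^2 C, and
   its norm is its spectral radius. The upper bound is the mean of
   |<A x, x>|^2 <= |A x|^2 and |<A x, x>|^2 <= |S x|^2, for x of norm 1. *)

Set Implicit Arguments.
Unset Strict Implicit.
Unset Printing Implicit Defensive.

Import Order.TTheory GRing.Theory Num.Theory.
Import numFieldNormedType.Exports.

Local Open Scope ring_scope.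

(** * The real part of the inner product and Cauchy-Schwarz *)

Section real_inner_product.
Context {R : realType} {H : hilbertType R}.
Implicit Types (x y z : H) (t : R).

Definition rnorm x : R := complex.Re `|x|.
(** A real inner product on [H] with the same norm; its value at ['i *: x] recovers the imaginary
    part, so no information is lost. *)
Definition rinner x y : R := complex.Re (inner x y).

Lemma ReD (a b : R[i]) : complex.Re (a + b) = complex.Re a + complex.Re b.
Proof. by case: a b => [? ?] [? ?]. Qed.

Lemma ReN (a : R[i]) : complex.Re (- a) = - complex.Re a.
Proof. by case: a. Qed.

Lemma ReZ t (a : R[i]) : complex.Re (t%:C%C * a) = t * complex.Re a.
Proof. by case: a => a b /=; rewrite mul0r subr0. Qed.

Lemma Re_norm_real t : 0 <= t -> complex.Re `|t%:C%C : R[i]| = t.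
Proof. by move=> t0; rewrite ger0_norm // ler0c. Qed.

Lemma rnormE x : `|x| = (rnorm x)%:C%C.
Proof. by rewrite RRe_real ?normr_real. Qed.

Lemma rnorm_ge0 x : 0 <= rnorm x.
Proof. by rewrite -ler0c -rnormE. Qed.

Lemma innerC x y : inner x y = (inner y x)^*%C.
Proof. by rewrite hermC expr0 mul1r. Qed.

Lemma innerZl (c : R[i]) x y : inner (c *: x) y = c * inner x y.
Proof. exact: linearZl_LR. Qed.

Lemma innerZr (c : R[i]) x y : inner x (c *: y) = c^*%C * inner x y.
Proof. by rewrite innerC innerZl rmorphM /= -innerC. Qed.

Lemma rinnerC x y : rinner x y = rinner y x.
Proof. by rewrite /rinner innerC; case: (inner y x). Qed.

Lemma rinnerDl x y z : rinner (x + y) z = rinner x z + rinner y z.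
Proof. by rewrite /rinner linearDl ReD. Qed.

Lemma rinnerZl t x y : rinner (t%:C%C *: x) y = t * rinner x y.
Proof.
by rewrite /rinner innerZl ReZ.
Qed.

Lemma rinnerNl x y : rinner (- x) y = - rinner x y.
Proof. by rewrite /rinner linearNl ReN. Qed.

Lemma rinnerBl x y z : rinner (x - y) z = rinner x z - rinner y z.
Proof. by rewrite rinnerDl rinnerNl. Qed.

Lemma rinnerDr x y z : rinner x (y + z) = rinner x y + rinner x z.
Proof. by rewrite ![rinner x _]rinnerC rinnerDl. Qed.

Lemma rinnerNr x y : rinner x (- y) = - rinner x y.
Proof. by rewrite rinnerC rinnerNl rinnerC. Qed.

Lemma rinnerBr x y z : rinner x (y - z) = rinner x y - rinner x z.
Proof. by rewrite rinnerDr rinnerNr. Qed.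

Lemma rinnerZr t x y : rinner x (t%:C%C *: y) = t * rinner x y.
Proof. by rewrite rinnerC rinnerZl rinnerC. Qed.

Lemma rinnerxx x : rinner x x = rnorm x ^+ 2.
Proof. by rewrite /rinner -inner_normE rnormE -rmorphXn. Qed.

Lemma rnorm0 : rnorm 0 = 0.
Proof. by rewrite /rnorm normr0. Qed.

Lemma rnorm0_eq0 x : rnorm x = 0 -> x = 0.
Proof. by move=> x0; apply/normr0_eq0; rewrite rnormE x0. Qed.

Lemma rnormN x : rnorm (- x) = rnorm x.
Proof. by rewrite /rnorm normrN. Qed.

Lemma rnormB x y : rnorm (x - y) = rnorm (y - x).
Proof. by rewrite -rnormN opprB. Qed.

Lemma rnormZ (c : R[i]) x : rnorm (c *: x) = complex.Re `|c| * rnorm x.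
Proof.
rewrite /rnorm normrZ rnormE -{1}(RRe_real (normr_real c)).
by rewrite -rmorphM.
Qed.

Lemma ler_rnormD x y : rnorm (x + y) <= rnorm x + rnorm y.
Proof. by rewrite -lecR rmorphD /= -!rnormE ler_normD. Qed.

Lemma rnorm_sqrD x y :
  rnorm (x + y) ^+ 2 = rnorm x ^+ 2 + rnorm y ^+ 2 + 2 * rinner x y.
Proof. by rewrite -!rinnerxx rinnerDl !rinnerDr (rinnerC y x); ring. Qed.

Lemma rnorm_sqrB x y :
  rnorm (x - y) ^+ 2 = rnorm x ^+ 2 + rnorm y ^+ 2 - 2 * rinner x y.
Proof. by rewrite rnorm_sqrD rnormN rinnerNr; ring. Qed.

Lemma rinner_le x y : rinner x y <= rnorm x * rnorm y.
Proof.
have [x0|x0] := eqVneq (rnorm x) 0.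
  by rewrite (rnorm0_eq0 x0) rnorm0 mul0r /rinner linear0l.
have [y0|y0] := eqVneq (rnorm y) 0.
  by rewrite (rnorm0_eq0 y0) rnorm0 mulr0 /rinner linear0r.
have xy : 0 < rnorm x * rnorm y by rewrite mulr_gt0 // lt_def ?x0 ?y0 rnorm_ge0.
(* This square equals [2 |x| |y| (|x| |y| - rinner x y)]. *)
have := sqr_ge0 (rnorm ((rnorm y)%:C%C *: x - (rnorm x)%:C%C *: y)).
rewrite rnorm_sqrB rinnerZl rinnerZr -!rinnerxx !rinnerZl !rinnerZr !rinnerxx => h.
rewrite -(ler_pM2l xy); nra.
Qed.

Lemma norm_rinner_le x y : `|rinner x y| <= rnorm x * rnorm y.
Proof. by rewrite ler_norml rinner_le andbT lerNl -rinnerNl -(rnormN x) rinner_le. Qed.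

(** Testing with [z = x - y] gives [|x - y|^2 = 0]. The linearity of the adjoint is obtained this
    way. *)
Lemma rinner_inj x y : (forall z, rinner z x = rinner z y) -> x = y.
Proof.
move=> xy; apply/eqP; rewrite -subr_eq0; apply/eqP/rnorm0_eq0/eqP.
by rewrite -sqrf_eq0 -rinnerxx rinnerBr xy subrr.
Qed.

(* Rotating by the phase of [inner x y] turns the modulus into a real part. *)
Lemma rotate_inner x y :
  exists2 u : R[i], `|u| = 1 & complex.Re `|inner x y| = rinner (u *: x) y.
Proof.
have [xy0|xy0] := eqVneq (inner x y) 0.
  exists 1; first exact: normr1.
  by rewrite scale1r /rinner xy0 normr0.
exists (`|inner x y| / inner x y).
  by rewrite normrM normfV normr_id divff ?normr_eq0.
by rewrite /rinner innerZl /= divfK.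
Qed.

Lemma norm_inner_le x y : complex.Re `|inner x y| <= rnorm x * rnorm y.
Proof.
have [u u1 ->] := rotate_inner x y.
by apply: le_trans (rinner_le _ _) _; rewrite rnormZ u1 /= mul1r.
Qed.

Lemma rinner_le_norm x y : rinner x y <= complex.Re `|inner x y|.
Proof.
rewrite -lecR (RRe_real (normr_real _)); apply: le_trans (normc_ge_Re _).
by rewrite lecR ler_norm.
Qed.

End real_inner_product.

(** * Completeness and Riesz representation *)

Section riesz.
Context {R : realType} {H : hilbertType R}.
Implicit Types (x y z : H) (t : R).

Lemma rnorm_complete (u : nat -> H) :
  (forall e : R, 0 < e -> exists N, forall m n, (N <= m)%N -> (N <= n)%N ->
     rnorm (u m - u n) < e) ->
  exists z, forall e : R, 0 < e -> exists N, forall n, (N <= n)%N -> rnorm (u n - z) < e.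
Proof.
move=> u_cauchy.
(* Positive elements of [R[i]] are real, so radii in [R] suffice. *)
have gt0E (e : R[i]) : 0 < e -> e = (complex.Re e)%:C%C /\ 0 < complex.Re e.
  move=> e0; have eE : (complex.Re e)%:C%C = e by rewrite RRe_real // gtr0_real.
  by split=> //; rewrite -ltcR eE.
have /cvg_ex[z uz] : (cvg (u @ \oo))%classic.
  apply: cauchy_cvg; apply: cauchy_exP => e /gt0E[-> e0].
  have [N uN] := u_cauchy _ e0; exists (u N); exists N => // n Nn.
  by rewrite -ball_normE /= rnormE ltcR uN.
exists z => e e0.
have e0c : 0 < e%:C%C by rewrite ltcR.
have [N _ uN] := (fcvgrPdist_lt _).1 uz _ e0c.
exists N => n Nn.
by rewrite -ltcR rnormB -rnormE; apply: uN.
Qed.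

Lemma vanishing_sequence : exists2 v : nat -> R, (forall n, 0 < v n) &
  forall e : R, 0 < e -> exists N, forall n, (N <= n)%N -> v n < e.
Proof.
exists (fun n => n.+1%:R^-1) => [n|e e0]; first by rewrite invr_gt0 ltr0n.
exists (Num.trunc e^-1) => n Nn.
rewrite invf_plt ?posrE ?ltr0n //.
by apply: lt_le_trans (truncnS_gt _) _; rewrite ler_nat.
Qed.

(* A minimizing sequence of [|x|^2 - 2 g x] is Cauchy by the parallelogram
   identity, and the Euler equation at its limit [z] is [g = rinner z]. *)
Lemma rinner_riesz (g : H -> R) (M : R) :
    (forall x y, g (x + y) = g x + g y) -> (forall t x, g (t%:C%C *: x) = t * g x) ->
    (forall x, g x <= M * rnorm x) ->
  exists z, forall x, g x = rinner x z.
Proof.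
move=> gD gZ gM; pose J x := rnorm x ^+ 2 - 2 * g x.
pose d := inf (range J).
(* Completing the square: [J x >= (|x| - M)^2 - M^2]. *)
have JM x : - M ^+ 2 <= J x.
  by have := gM x; have := sqr_ge0 (rnorm x - M); rewrite /J; nra.
have Jlb : has_inf (range J).
  split; first by exists (J 0); exists 0.
  by exists (- M ^+ 2) => _ [x _ <-].
have dJ x : d <= J x by apply: ge_inf; [case: Jlb | exists x].
have JD x h : J (x + h) = J x + rnorm h ^+ 2 + 2 * (rinner h x - g h).
  by rewrite /J rnorm_sqrD gD (rinnerC x h); ring.
have [v v_gt0 v_lim] := vanishing_sequence.
have /choice[u Ju] n : exists x, J x < d + v n.
  by have [_ [x _ <-] ?] := inf_adherent (v_gt0 n) Jlb; exists x.
have parallelogram x y : rnorm (x - y) ^+ 2 <= 2 * J x + 2 * J y - 4 * d.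
  have := dJ ((2^-1)%:C%C *: (x + y)).
  rewrite /J gZ gD rnormZ exprMn rnorm_sqrB rnorm_sqrD.
  rewrite Re_norm_real //.
  by lra.
have [z uz] : exists z, forall e : R, 0 < e ->
    exists N, forall n, (N <= n)%N -> rnorm (u n - z) < e.
  apply: rnorm_complete => e e0.
  (* By [parallelogram], [|u m - u n|^2 < 2 v m + 2 v n], hence the tolerance [e^2 / 4]. *)
  have [|N uN] := v_lim (e ^+ 2 / 4); first by rewrite divr_gt0 ?exprn_gt0.
  exists N => m n Nm Nn.
  rewrite -(@ltr_pXn2r _ 2) ?nnegrE ?rnorm_ge0 ?ltW //.
  apply: le_lt_trans (parallelogram _ _) _.
  by have := uN _ Nm; have := uN _ Nn; have := Ju m; have := Ju n; lra.
exists z => h.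
(* Minimality passes to the limit: [d <= J (u n + k)] and [J (u n) < d + v n], while
   [rinner k (u n - z)] tends to 0. *)
have quad s : 0 <= rnorm (s%:C%C *: h) ^+ 2 + 2 * (s * (rinner h z - g h)).
  set k := s%:C%C *: h; have kE : s * (rinner h z - g h) = rinner k z - g k.
    by rewrite /k rinnerZl gZ; ring.
  rewrite kE; apply/ler_addgt0Pr => e e0.
  have k0 : 0 < 2 * rnorm k + 1 by rewrite ltr_wpDl // mulr_ge0 ?rnorm_ge0.
  have e20 : 0 < e / 2 by rewrite divr_gt0.
  have [N1 uN1] := v_lim _ e20.
  have [N2 uN2] := uz _ (divr_gt0 e20 k0).
  pose n := maxn N1 N2.
  have h1 := uN1 n (leq_maxl _ _).
  have h2 := uN2 n (leq_maxr _ _).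
  have h3 := Ju n.
  have := dJ (u n + k); rewrite JD => h4.
  have := rinner_le k (u n - z); rewrite rinnerBr => h5.
  move: h2; rewrite ltr_pdivlMr // => h2.
  by have := rnorm_ge0 (u n - z); have := rnorm_ge0 k; nra.
apply/eqP; rewrite eq_sym -subr_eq0.
set a := rinner h z - g h in quad *.
have c0 : 0 < rnorm h ^+ 2 + 1 by rewrite ltr_wpDl // sqr_ge0.
(* A step against the slope [a]: with [c = |h|^2 + 1] the bound becomes [0 <= - a^2 (c + 1) / c^2],
   which forces [a = 0]. The added 1 covers [h = 0]. *)
have := quad (- a / (rnorm h ^+ 2 + 1)).
rewrite rnormZ normc_def /= expr0n addr0 sqrtr_sqr exprMn real_normK ?num_real //.
set c := _ + 1 in c0 *.
have -> : (- a / c) ^+ 2 * rnorm h ^+ 2 + 2 * (- a / c * a) = - a ^+ 2 * (c + 1) / c ^+ 2.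
  have -> : rnorm h ^+ 2 = c - 1 by rewrite /c addrK.
  by field; rewrite gt_eqF.
rewrite pmulr_lge0 ?invr_gt0 ?exprn_gt0 // pmulr_lge0; last by rewrite ltr_wpDr.
by rewrite oppr_ge0 => a0; rewrite -sqrf_eq0 eq_le a0 sqr_ge0.
Qed.

End riesz.

(** * Symmetric operators, and pairs of a symmetric and a skew operator *)

Lemma exp_gt_geometric (R : realType) (K q r : R) : 0 <= q -> q < r ->
  exists n, K * q ^+ n < r ^+ n.+1.
Proof.
move=> q0 qr; have r0 := le_lt_trans q0 qr.
have qr1 : `|q / r| < 1.
  by rewrite ger0_norm ?divr_ge0 // ?ltr_pdivrMr ?mul1r // ltW.
(* Divided by [r ^ n], the claim reads [K (q / r)^n < r], and the left side tends to 0. *)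
have lim : ((K * (q / r) ^+ n) @[n --> \oo] --> K * 0)%classic.
  by apply: cvgMr; exact: cvg_expr.
rewrite mulr0 in lim.
have [N _ lN] := cvgr_lt _ lim _ r0; exists N.
have := lN N (leqnn N); rewrite /= exprMn exprVn mulrA.
by rewrite ltr_pdivrMr ?exprn_gt0 // -exprS.
Qed.

Lemma Re_mulil {R : realType} (a : R[i]) : complex.Re ('i%C * a) = - complex.Im a.
Proof. by rewrite mulrC ReiNIm. Qed.

Section operators.
Context {R : realType} {H : hilbertType R}.
Implicit Types (A B C P T : H -> H) (x y z : H) (t : R).

(** Only real parts are compared; for a complex-linear [B] this already amounts to
    self-adjointness. *)
Definition rsymmetric B := forall x y, rinner (B x) y = rinner x (B y).

(* The norms [a n] of the iterates satisfy [a (n+1)^2 <= a n * a (n+2)], so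
   they grow at least like a geometric progression of ratio [a 1 / a 0]. *)
Lemma rsymmetric_iter_bound P (K q : R) : rsymmetric P -> 0 <= q ->
    (forall n x, rnorm (iter n.+1 P x) <= K * q ^+ n * rnorm x) ->
  forall x, rnorm (P x) <= q * rnorm x.
Proof.
move=> Psym q0 Pq x; rewrite leNgt; apply/negP => qx.
pose a n := rnorm (iter n P x).
have a_ge0 n : 0 <= a n by exact: rnorm_ge0.
have convex n : a n.+1 ^+ 2 <= a n * a n.+2.
  by rewrite -rinnerxx /= Psym; exact: rinner_le.
have a0 : 0 < a 0.
  rewrite lt_def a_ge0 andbT; apply/eqP => x0.
  have := Pq 0 x; rewrite -/(a 0) -/(a 1) x0 mulr0.
  by move: qx; rewrite -/(a 0) -/(a 1) x0 mulr0 => /lt_le_trans h/h; rewrite ltxx.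
pose r := a 1 / a 0.
have qr : q < r by rewrite ltr_pdivlMr.
have r0 := le_lt_trans q0 qr.
have growth n : 0 < a n /\ r * a n <= a n.+1.
  elim: n => [|n [an ran]]; first by rewrite a0 divfK ?gt_eqF.
  have an1 : 0 < a n.+1 by apply: lt_le_trans ran; rewrite mulr_gt0.
  split=> //; rewrite -(ler_pM2l an); apply: le_trans (convex n).
  by rewrite expr2 mulrCA mulrA ler_pM2r.
have power n : r ^+ n * a 0 <= a n.
  elim: n => [|n IHn]; first by rewrite mul1r.
  apply: le_trans (growth n).2.
  by rewrite exprS -mulrA ler_pM2l.
(* For some [n] the lower bound [r ^ n.+1 * a 0] exceeds the upper bound [K * q ^ n * a 0] on the
   same [a n.+1]. *)
have [n] := exp_gt_geometric K q0 qr.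
rewrite -(ltr_pM2r a0) => /lt_le_trans/(_ (power n.+1))/lt_le_trans/(_ (Pq n x)).
by rewrite ltxx.
Qed.

Section symmetric_skew_pair.
Variables (B C : H -> H) (W Q : R).
Hypothesis B_sym : rsymmetric B.
Hypothesis C_skew : forall x y, rinner (C x) y = - rinner x (C y).
Hypothesis W_ge0 : 0 <= W.
Hypothesis B_le : forall x, rnorm (B x) <= W * rnorm x.
Hypothesis C_le : forall x, rnorm (C x) <= W * rnorm x.
Hypothesis Q_ge0 : 0 <= Q.
Hypothesis BBCC_le : forall x, rnorm (B (B (C (C x)))) <= Q * rnorm x.

(** With [P = C B^2 C], [|B C x|^2 = - <x, P x> <= |x| |P x|], so it is enough to bound [P] by
    [Q]. *)
Lemma rnorm_mul_sqr x : rnorm (B (C x)) ^+ 2 <= Q * rnorm x ^+ 2.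
Proof.
pose P x := C (B (B (C x))); pose D x := B (B (C (C x))).
have P_sym : rsymmetric P.
  by move=> y z; rewrite C_skew B_sym B_sym C_skew opprK.
have iterP n y : iter n.+1 P y = C (iter n D (B (B (C y)))).
  by elim: n => // n IHn; rewrite iterS IHn.
have iterD n y : rnorm (iter n D y) <= Q ^+ n * rnorm y.
  elim: n => [|n IHn]; first by rewrite mul1r.
  by rewrite iterS exprS -mulrA; apply: le_trans (BBCC_le _) (ler_wpM2l Q_ge0 IHn).
have P_le : rnorm (P x) <= Q * rnorm x.
  (* The factors [C], [B], [B], [C] around [D^n] in [P^(n+1)] cost one [W] each. *)
  apply: (@rsymmetric_iter_bound P (W ^+ 4)) => // n y.
  rewrite iterP; apply: le_trans (C_le _) _.
  have -> : W ^+ 4 * Q ^+ n * rnorm y = W * (Q ^+ n * (W * (W * (W * rnorm y)))) by ring.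
  apply: ler_wpM2l => //; apply: le_trans (iterD _ _) _.
  apply: ler_wpM2l; first exact: exprn_ge0.
  apply: le_trans (B_le _) _; apply: ler_wpM2l => //.
  by apply: le_trans (B_le _) _; apply: ler_wpM2l.
rewrite -rinnerxx B_sym C_skew -rinnerNr; apply: le_trans (rinner_le _ _) _.
rewrite rnormN mulrC expr2 mulrA.
by apply: ler_wpM2r => //; exact: rnorm_ge0.
Qed.

(** When the square is expanded, the cross term is [<x, B C y>], at most [sqrt Q |x| |y|], and
    [2 |x| |y| <= |x|^2 + |y|^2]. *)
Lemma rnorm_sub_sqr_le x y :
  rnorm (B x - C y) ^+ 2 <= (W ^+ 2 + Num.sqrt Q) * (rnorm x ^+ 2 + rnorm y ^+ 2).
Proof.
have cross : `|rinner (B x) (C y)| <= Num.sqrt Q * (rnorm x * rnorm y).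
  rewrite B_sym; apply: le_trans (norm_rinner_le _ _) _.
  rewrite mulrCA; apply: ler_wpM2l; first exact: rnorm_ge0.
  rewrite -(@ler_pXn2r _ 2) ?nnegrE ?mulr_ge0 ?rnorm_ge0 ?sqrtr_ge0 //.
  by rewrite exprMn sqr_sqrtr //; exact: rnorm_mul_sqr.
have sqr_le (D : H -> H) z : (forall w, rnorm (D w) <= W * rnorm w) ->
    rnorm (D z) ^+ 2 <= W ^+ 2 * rnorm z ^+ 2.
  by move=> DW; rewrite -exprMn ler_pXn2r ?nnegrE ?mulr_ge0 ?rnorm_ge0.
rewrite rnorm_sqrB.
move: cross (sqr_le _ x B_le) (sqr_le _ y C_le); rewrite ler_norml => /andP[h _].
have := sqr_ge0 (rnorm x - rnorm y); have := sqrtr_ge0 Q; nra.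
Qed.

(* [u := B x] and [v := C x] give [B u - C v = B^2 x - C^2 x], while
   [|u|^2 + |v|^2 = <B^2 x - C^2 x, x>]. *)
Lemma rnorm_sub_squares_le x :
  rnorm (B (B x) - C (C x)) <= (W ^+ 2 + Num.sqrt Q) * rnorm x.
Proof.
set T := B (B x) - C (C x).
have [T0|T0] := eqVneq (rnorm T) 0.
  by rewrite T0 mulr_ge0 ?rnorm_ge0 // addr_ge0 ?sqrtr_ge0 ?exprn_ge0.
have T_gt0 : 0 < rnorm T by rewrite lt_def T0 rnorm_ge0.
rewrite -(ler_pM2l T_gt0) -expr2; apply: le_trans (rnorm_sub_sqr_le _ _) _.
have -> : rnorm (B x) ^+ 2 + rnorm (C x) ^+ 2 = rinner T x.
  by rewrite -!rinnerxx /T rinnerBl B_sym C_skew (rinnerC x (B _)) (rinnerC x (C _)).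
rewrite mulrCA; apply: ler_wpM2l; last exact: rinner_le.
by rewrite addr_ge0 ?sqrtr_ge0 ?exprn_ge0.
Qed.

End symmetric_skew_pair.

(** Polarization: [4 <B y, z>] is the difference of the quadratic form at [y + z] and at [y - z];
    the parallelogram identity adds up the two bounds. *)
Lemma rsymmetric_norm_le B (w : R) : (forall x y, B (x + y) = B x + B y) ->
    rsymmetric B -> 0 <= w -> (forall x, `|rinner (B x) x| <= w * rnorm x ^+ 2) ->
  forall x, rnorm (B x) <= w * rnorm x.
Proof.
move=> BD Bsym w0 Bw x.
have BB y z : (rinner (B (y - z)) (y - z)) =
    rinner (B y) y + rinner (B z) z - 2 * rinner (B y) z.
  have -> : B (y - z) = B y - B z.
    by apply/eqP; rewrite eq_sym subr_eq -BD subrK.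
  by rewrite rinnerBl !rinnerBr (rinnerC (B z) y) (Bsym y z); ring.
have polar y z : 2 * rinner (B y) z <= w * (rnorm y ^+ 2 + rnorm z ^+ 2).
  have := Bw (y + z); have := Bw (y - z); rewrite !ler_norml BB BD.
  rewrite rinnerDl !rinnerDr (rinnerC (B z) y) -(Bsym y z) rnorm_sqrB rnorm_sqrD.
  by move=> /andP[+ _] /andP[_ +]; nra.
have [x0|x0] := eqVneq (rnorm x) 0.
  have -> : B x = 0 by rewrite (rnorm0_eq0 x0); apply: (@addrI _ (B 0)); rewrite -BD !addr0.
  by rewrite rnorm0 mulr_ge0 ?rnorm_ge0.
have [Bx0|Bx0] := eqVneq (rnorm (B x)) 0.
  by rewrite Bx0 mulr_ge0 ?rnorm_ge0.
have a0 : 0 < rnorm x by rewrite lt_def x0 rnorm_ge0.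
have b0 : 0 < rnorm (B x) by rewrite lt_def Bx0 rnorm_ge0.
(* Both vectors are scaled to the norm [|x| |B x|], where [polar] is sharpest. *)
have := polar ((rnorm (B x))%:C%C *: x) ((rnorm x)%:C%C *: B x).
rewrite Bsym rinnerZl -Bsym rinnerZr rinnerxx !rnormZ !Re_norm_real ?rnorm_ge0 // => h.
have ab0 : 0 < rnorm x * rnorm (B x) ^+ 2 by rewrite mulr_gt0 ?exprn_gt0.
by rewrite -(ler_pM2l ab0); nra.
Qed.

(** As [adjoint] is chosen by [get], its defining property follows from existence, which Riesz gives
    for the real part of [<A x, y>]. *)
Lemma inner_adjoint (A : {linear H -> H}) (M : R) :
    (forall x, rnorm (A x) <= M * rnorm x) ->
  forall x y, inner (A x) y = inner x (adjoint A y).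
Proof.
move=> AM; suff /getPex : exists B, forall x y, inner (A x) y = inner x (B y) by [].
suff /choice[B AB] y : exists z, forall x, inner (A x) y = inner x z.
  by exists B => x y; exact: AB.
have [||x|z Az] := @rinner_riesz R H (fun x => rinner (A x) y) (M * rnorm y).
- by move=> x z; rewrite linearD rinnerDl.
- by move=> t x; rewrite linearZ rinnerZl.
- apply: le_trans (rinner_le _ _) _; rewrite mulrAC.
  by apply: ler_wpM2r => //; exact: rnorm_ge0.
(* Evaluation at ['i *: x] compares the imaginary parts. *)
exists z => x; have := Az x; have := Az ('i%C *: x).
rewrite linearZ /rinner !innerZl !Re_mulil => /oppr_inj ImE ReE.
by rewrite [LHS]complexE [RHS]complexE ImE ReE.
Qed.

End operators.

(** * Operator norm and numerical radius as suprema *)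

Lemma sup_nonneg (R : realType) (E : set R) : (forall t, E t -> 0 <= t) -> 0 <= sup E.
Proof.
move=> E0; have [[[t Et] Eub]|Esup] := pselect (has_sup E).
  exact: le_trans (E0 t Et) (ub_le_sup Eub Et).
(* On an empty set or one unbounded above, [sup] takes the default value 0. *)
by rewrite sup_out.
Qed.

Section bounded_operators.
Context {R : realType} {H : hilbertType R}.
Implicit Types (T : H -> H) (x y z : H) (t M c w : R).

Lemma unit_scaling x : x != 0 -> rnorm ((rnorm x)^-1%:C%C *: x) = 1.
Proof.
move=> x0; have nx0 : rnorm x != 0 by apply: contra_neq x0; exact: rnorm0_eq0.
by rewrite rnormZ Re_norm_real ?invr_ge0 ?rnorm_ge0 // mulVf.
Qed.

Lemma opnorm_le T c : 0 <= c -> (forall x, rnorm (T x) <= c * rnorm x) -> opnorm T <= c.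
Proof.
move=> c0 Tc; apply: ge_sup; first by exists (rnorm (T 0)), 0 => //=; rewrite normr0.
move=> _ [x /= x1 <-]; apply: le_trans (Tc x) _.
by rewrite ler_piMr // -lecR -rnormE.
Qed.

(** The constant [M] bounds the set, so that its [sup] is a genuine supremum; homogeneity then
    reduces to the unit vector [x / |x|]. *)
Lemma le_opnorm T M : (forall t x, T (t%:C%C *: x) = t%:C%C *: T x) ->
    (forall x, rnorm (T x) <= M * rnorm x) ->
  forall x, rnorm (T x) <= opnorm T * rnorm x.
Proof.
move=> TZ TM x; have [->|x0] := eqVneq x 0.
  by apply: le_trans (TM 0) _; rewrite rnorm0 !mulr0.
have nx0 : 0 < rnorm x.
  by rewrite lt_def rnorm_ge0 andbT; apply: contra_neq x0; exact: rnorm0_eq0.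
have bnd : has_ubound [set complex.Re `|T x| | x in [set x : H | `|x| <= 1]]%classic.
  exists `|M| => _ [y /= y1 <-]; apply: le_trans (TM y) _.
  apply: le_trans (ler_wpM2r (rnorm_ge0 y) (ler_norm M)) _.
  by rewrite ler_piMr // -lecR -rnormE.
have : rnorm (T ((rnorm x)^-1%:C%C *: x)) <= opnorm T.
  apply: ub_le_sup bnd _ _; exists ((rnorm x)^-1%:C%C *: x) => //=.
  by rewrite rnormE unit_scaling.
by rewrite TZ rnormZ Re_norm_real ?invr_ge0 ?rnorm_ge0 // mulrC ler_pdivrMr.
Qed.

Lemma opnorm_ge0 T : 0 <= opnorm T.
Proof. by apply: sup_nonneg => _ [x _ <-]; exact: rnorm_ge0. Qed.

Lemma Re_norm_ge0 (a : R[i]) : 0 <= complex.Re `|a|.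
Proof. by rewrite -ler0c (RRe_real (normr_real a)). Qed.

Lemma numerical_radius_ge0 T : 0 <= numerical_radius T.
Proof. by apply: sup_nonneg => _ [x _ <-]; exact: Re_norm_ge0. Qed.

Lemma numerical_radius_le T c : 0 <= c ->
    (forall x, rnorm x = 1 -> complex.Re `|inner (T x) x| <= c) ->
  numerical_radius T <= c.
Proof.
move=> c0 Tc; rewrite /numerical_radius; set E := [set _ | _ in _]%classic.
(* In a trivial space there is no unit vector, and the numerical radius is 0. *)
have [->|E0] := eqVneq E set0; first by rewrite sup0.
apply: ge_sup; first exact/set0P.
by move=> _ [x /= x1 <-]; apply: Tc; rewrite /rnorm x1.
Qed.

Lemma le_numerical_radius T M : (forall t x, T (t%:C%C *: x) = t%:C%C *: T x) ->
    (forall x, rnorm (T x) <= M * rnorm x) ->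
  forall x, complex.Re `|inner (T x) x| <= numerical_radius T * rnorm x ^+ 2.
Proof.
move=> TZ TM x; have [->|x0] := eqVneq x 0.
  by apply: le_trans (norm_inner_le _ _) _; rewrite rnorm0 expr0n !mulr0.
have nx0 : 0 < rnorm x.
  by rewrite lt_def rnorm_ge0 andbT; apply: contra_neq x0; exact: rnorm0_eq0.
have bnd : has_ubound
    [set complex.Re `|inner (T x) x| | x in [set x : H | `|x| = 1]]%classic.
  exists M => _ [y /= y1 <-]; apply: le_trans (norm_inner_le _ _) _.
  by apply: le_trans (ler_wpM2r (rnorm_ge0 y) (TM y)) _; rewrite /rnorm y1 !mulr1.
set y := (rnorm x)^-1%:C%C *: x.
have : complex.Re `|inner (T y) y| <= numerical_radius T.
  by apply: ub_le_sup bnd _ _; exists y; rewrite //= rnormE unit_scaling.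
have xE : x = (rnorm x)%:C%C *: y.
  by rewrite scalerA -rmorphM /= mulfV ?gt_eqF // scale1r.
(* A phase turns the modulus into a real part, from which real homogeneity extracts [|x|^2]. *)
have [u u1 ->] := rotate_inner (T x) x.
have -> : rinner (u *: T x) x = rnorm x ^+ 2 * rinner (u *: T y) y.
  by rewrite {1 2}xE TZ scalerA mulrC -scalerA rinnerZl rinnerZr mulrA.
move=> h; rewrite mulrC ler_pM2r ?exprn_gt0 //; apply: le_trans h.
apply: le_trans (rinner_le_norm _ _) _.
by rewrite innerZl normrM u1 mul1r.
Qed.

(** Multiplication by ['i] is skew for the real form, hence it exchanges symmetric and skew
    operators that commute with it. *)
Lemma rinner_Zi_l x y : rinner ('i%C *: x) y = - rinner x ('i%C *: y).
Proof.
have ImJ (a : R[i]) : complex.Im a^*%C = - complex.Im a by case: a.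
by rewrite (rinnerC x) /rinner !innerZl !Re_mulil (innerC y x) ImJ opprK.
Qed.

End bounded_operators.

(** * The adjoint [S] of [A], and the operators [A + S] and [A - S] *)

Section adjoint.
Context {R : realType} {H : hilbertType R}.
Variables (A : {linear H -> H}) (M : R).
Hypothesis A_le : forall x, rnorm (A x) <= M * rnorm x.

Let AZ (t : R) x : A (t%:C%C *: x) = t%:C%C *: A x.
Proof. exact: linearZ. Qed.

Lemma rinner_adjointr x y : rinner (A x) y = rinner x (adjoint A y).
Proof. by rewrite /rinner (inner_adjoint A_le). Qed.

Lemma rinner_adjointl x y : rinner (adjoint A x) y = rinner x (A y).
Proof. by rewrite rinnerC -rinner_adjointr rinnerC. Qed.

Lemma adjointD x y : adjoint A (x + y) = adjoint A x + adjoint A y.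
Proof. by apply: rinner_inj => z; rewrite rinnerDr -!rinner_adjointr rinnerDr. Qed.

Lemma adjointZ (c : R[i]) x : adjoint A (c *: x) = c *: adjoint A x.
Proof.
apply: rinner_inj => z; rewrite /rinner -(inner_adjoint A_le).
by rewrite !innerZr (inner_adjoint A_le).
Qed.

Lemma adjointN x : adjoint A (- x) = - adjoint A x.
Proof. by rewrite -scaleN1r adjointZ scaleN1r. Qed.

(** [|S x|^2 = <x, A S x> <= M |x| |S x|] for the adjoint [S], and one factor cancels. *)
Lemma rnorm_adjoint_le x : rnorm (adjoint A x) <= M * rnorm x.
Proof.
have [->|x0] := eqVneq (rnorm (adjoint A x)) 0.
  by apply: le_trans (rnorm_ge0 _) (A_le x).
have a0 : 0 < rnorm (adjoint A x) by rewrite lt_def x0 rnorm_ge0.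
rewrite -(ler_pM2l a0) -expr2 -rinnerxx rinner_adjointl.
apply: le_trans (rinner_le _ _) _.
apply: le_trans (ler_wpM2l (rnorm_ge0 x) (A_le _)) _.
by rewrite mulrC mulrAC mulrC.
Qed.

(** A rotation keeps the modulus, which dominates the real part. The case [u = 1] serves [A + S],
    the case [u = 'i] serves [A - S]. *)
Lemma norm_rinner_rot_le (u : R[i]) x : `|u| = 1 ->
  `|rinner (u *: A x) x| <= numerical_radius A * rnorm x ^+ 2.
Proof.
move=> u1; apply: le_trans (le_numerical_radius AZ A_le x).
rewrite -(mul1r `|inner _ _|) -u1 -normrM -innerZl -lecR RRe_real ?normr_real //.
exact: normc_ge_Re.
Qed.

Let AD (x y : H) : A (x + y) = A x + A y.
Proof. exact: linearD. Qed.

Let w_ge0 : 0 <= 2 * numerical_radius A.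
Proof. by rewrite mulr_ge0 ?numerical_radius_ge0. Qed.

Lemma add_adjoint_sym : rsymmetric (fun x => A x + adjoint A x).
Proof. by move=> x y; rewrite rinnerDl rinnerDr rinner_adjointr rinner_adjointl addrC. Qed.

Lemma sub_adjoint_skew x y :
  rinner (A x - adjoint A x) y = - rinner x (A y - adjoint A y).
Proof. by rewrite rinnerBl rinnerBr rinner_adjointr rinner_adjointl opprB. Qed.

(** The quadratic form of [A + S] is [2 Re <A y, y>], and for a symmetric operator a bound on the
    form bounds the norm. *)
Lemma add_adjoint_le x : rnorm (A x + adjoint A x) <= 2 * numerical_radius A * rnorm x.
Proof.
apply: (@rsymmetric_norm_le _ _ (fun x => A x + adjoint A x)) => //.
- by move=> y z; rewrite AD adjointD addrACA.
- exact: add_adjoint_sym.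
- move=> y; rewrite rinnerDl rinner_adjointl (rinnerC y).
  have -> : rinner (A y) y + rinner (A y) y = 2 * rinner (A y) y by ring.
  rewrite normrM ger0_norm //.
  by rewrite -mulrA ler_pM2l // -[A y]scale1r norm_rinner_rot_le ?normr1.
Qed.

(* Multiplying by the unimodular ['i] makes the skew operator symmetric. *)
Lemma sub_adjoint_le x : rnorm (A x - adjoint A x) <= 2 * numerical_radius A * rnorm x.
Proof.
have i1 : `|'i%C : R[i]| = 1 by rewrite normc_def /= expr0n expr1n add0r sqrtr1.
have -> : rnorm (A x - adjoint A x) = rnorm ('i%C *: (A x - adjoint A x)).
  by rewrite rnormZ i1 mul1r.
apply: (@rsymmetric_norm_le _ _ (fun x => 'i%C *: (A x - adjoint A x))) => //.
- by move=> y z; rewrite -scalerDr AD adjointD opprD addrACA.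
- move=> y z; rewrite rinner_Zi_l sub_adjoint_skew opprK.
  by rewrite linearZ adjointZ scalerBr.
- move=> y; have -> : rinner ('i%C *: (A y - adjoint A y)) y = 2 * rinner ('i%C *: A y) y.
    rewrite scalerBr rinnerBl -adjointZ rinner_adjointl.
    by rewrite (rinner_Zi_l y) (rinnerC y); ring.
  by rewrite normrM ger0_norm // -mulrA ler_pM2l // norm_rinner_rot_le.
Qed.

End adjoint.

(** * The two inequalities for a bounded operator *)

Lemma bounded_operator_linear (R : realType) (H : hilbertType R) (A : H -> H) :
    bounded_operator A ->
  exists2 L : {linear H -> H}, A = L &
    exists2 M : R, 0 <= M & forall x, rnorm (L x) <= M * rnorm x.
Proof.
move=> [A_lin [M AM]].
pose L : {linear H -> H} := HB.pack A (GRing.isLinear.Build _ _ _ _ A A_lin).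
exists L => //; exists (Num.max M 0); first by rewrite le_max lexx orbT.
move=> x; have /= := AM x; rewrite !rnormE -rmorphM lecR => /le_trans; apply.
by apply: ler_wpM2r (rnorm_ge0 x) _ _ _; rewrite le_max lexx.
Qed.

Theorem corollary2p21 (R : realType) (H : hilbertType R) (A : H -> H)
    (A_bounded : bounded_operator A) :
  2^-1 * opnorm ((adjoint A \o A) + (A \o adjoint A))
    - 4^-1 * Num.sqrt (opnorm (iter 2 (A + adjoint A) \o iter 2 (A - adjoint A)))
    <= numerical_radius A ^+ 2
  /\ numerical_radius A ^+ 2
    <= 2^-1 * opnorm ((adjoint A \o A) + (A \o adjoint A)).
Proof.
have [L -> [M M0 LM]] := bounded_operator_linear A_bounded.
have LZ (t : R) x : L (t%:C%C *: x) = t%:C%C *: L x by exact: linearZ.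
have L'M := rnorm_adjoint_le LM.
set w := numerical_radius L; have w0 : 0 <= w by exact: numerical_radius_ge0.
split.
- set T := _ \o iter 2 _; set Q := opnorm T.
  have Q0 : 0 <= Q by exact: opnorm_ge0.
  pose B x := L x + adjoint L x; pose C x := L x - adjoint L x.
  have TE x : T x = B (B (C (C x))) by [].
  have TQ x : rnorm (B (B (C (C x)))) <= Q * rnorm x.
    (* The a priori constant has one factor [2 w] for each of [B], [B], [C], [C]. *)
    rewrite -TE; apply: (@le_opnorm _ _ _ ((2 * w) ^+ 4)) => [t y|y].
      by rewrite !TE /B /C !(linearZ, adjointZ LM, =^~ scalerDr, =^~ scalerBr).
    rewrite TE; apply: le_trans (add_adjoint_le LM _) _.
    have -> : (2 * w) ^+ 4 * rnorm y = 2 * w * (2 * w * (2 * w * (2 * w * rnorm y))) by ring.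
    have w20 : 0 <= 2 * w by rewrite mulr_ge0.
    apply: ler_wpM2l => //; apply: le_trans (add_adjoint_le LM _) _.
    apply: ler_wpM2l => //; apply: le_trans (sub_adjoint_le LM _) _.
    by apply: ler_wpM2l => //; exact: (sub_adjoint_le LM).
  (* Half of this bound is [w^2 + sqrt Q / 4]. *)
  suff : opnorm ((adjoint L \o L) + (L \o adjoint L)) <= ((2 * w) ^+ 2 + Num.sqrt Q) / 2.
    by lra.
  apply: opnorm_le => [|x].
    by rewrite divr_ge0 ?addr_ge0 ?sqrtr_ge0 ?sqr_ge0.
  have := rnorm_sub_squares_le (add_adjoint_sym LM) (sub_adjoint_skew LM)
    (mulr_ge0 (ler0n _ 2) w0) (add_adjoint_le LM) (sub_adjoint_le LM) Q0 TQ x.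
  (* In [B^2 - C^2] the squares of [L] and of its adjoint cancel, and the mixed products double. *)
  set D := (_ - _); have -> : D = 2%:C%C *: (adjoint L (L x) + L (adjoint L x)).
    rewrite /D (linearD L) (linearB L) !(adjointD LM) (adjointN LM).
    have -> : 2%:C%C = 2%:R :> R[i] by rewrite -(rmorph_nat (real_complex R)).
    rewrite scaler_nat mulr2n !opprB [X in _ + X = _]addrC addrACA.
    rewrite [L (L x) + _]addrC [X in X + _ = _]addrACA subrr addr0.
    rewrite [X in _ + X = _]addrACA subrr addr0.
    by rewrite addrACA [L (adjoint L x) + _]addrC.
  rewrite rnormZ Re_norm_real //.
  rewrite fctE /=; lra.
- set S := _ + _.
  have SZ (t : R) x : S (t%:C%C *: x) = t%:C%C *: S x.
    by rewrite /S !fctE /= LZ (adjointZ LM) (adjointZ LM) LZ scalerDr.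
  have SM x : rnorm (S x) <= (2 * M ^+ 2) * rnorm x.
    apply: le_trans (ler_rnormD _ _) _ => /=.
    have := LM x; have := L'M x; have := L'M (L x); have := LM (adjoint L x).
    have := rnorm_ge0 x; nra.
  have S_ge0 := opnorm_ge0 S.
  (* Square roots turn the goal into a bound on [w] itself, to be checked on unit vectors. *)
  rewrite -[leRHS]sqr_sqrtr ?mulr_ge0 // ler_pXn2r ?nnegrE ?sqrtr_ge0 //.
  apply: numerical_radius_le => [|x x1]; first exact: sqrtr_ge0.
  rewrite -(@ler_pXn2r _ 2) ?nnegrE ?sqrtr_ge0 ?Re_norm_ge0 // sqr_sqrtr ?mulr_ge0 //.
  have h1 : complex.Re `|inner (L x) x| <= rnorm (L x).
    by apply: le_trans (norm_inner_le _ _) _; rewrite x1 mulr1.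
  have h2 : complex.Re `|inner (L x) x| <= rnorm (adjoint L x).
    by rewrite (inner_adjoint LM); apply: le_trans (norm_inner_le _ _) _; rewrite x1 mul1r.
  (* The sum is [<S x, x>]; by [h1] and [h2] it dominates [2 |<L x, x>|^2]. *)
  have h3 : rnorm (L x) ^+ 2 + rnorm (adjoint L x) ^+ 2 <= opnorm S.
    have -> : rnorm (L x) ^+ 2 + rnorm (adjoint L x) ^+ 2 = rinner (S x) x.
      rewrite /S !fctE rinnerDl (rinner_adjointl LM) (rinner_adjointr LM (adjoint L x)).
      by rewrite !rinnerxx.
    apply: le_trans (rinner_le _ _) _; rewrite x1 mulr1.
    by apply: le_trans (le_opnorm SZ SM x) _; rewrite x1 mulr1.
  have := Re_norm_ge0 (inner (L x) x); nra.
Qed.
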